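(* Let $S^w$ and $S$ be the weak Pareto solution set and the Pareto solution set of the fully piecewise linear vector optimization problem (PLP) described in the context, respectively. Suppose that the ordering cone $C$ is polyhedral. Then the following statements hold: (i) (If $\mathrm{int}(C)\neq\emptyset$, so that weak Pareto solutions are defined.) There exist finitely many (possibly zero) polyhedra $F_1,\dots,F_p$ in $X$ such that $S^w=\bigcup_{k=1}^pF_k$ and each $F_k$ is contained in a weak Pareto face of some linear subproblem $(\mathrm{LP})_i$. (ii) There exist finitely many (possibly zero) generalized polyhedra $F_1,\dots,F_p$ in $X$ such that $S=\bigcup_{k=1}^pF_k$ and each $F_k$ is contained in a Pareto face of some linear subproblem $(\mathrm{LP})_i$.
   Context: Notation. $\overline{1m}:=\{1,\dots,m\}$; $\mathcal{L}(X,Y)$ is the space of continuous linear operators. A polyhedron in a normed space $W$ is the solution set of finitely many inequalities $\langle u^*,x\rangle\le s$ with $u^*\in W^*$, $s\in\mathbb{R}$; a cone is polyhedral if it is a polyhedron. A generalized polyhedron in $W$ is a set $P\cap\{w\in W:\langle v_i^*,w\rangle<t_i,\ 1\le i\le k\}$ with $P$ a polyhedron, $v_i^*\in W^*$, $t_i\in\mathbb{R}$. A face of a polyhedron $P$ means an exposed face: a set $\{u\in P:\langle x^*,u\rangle=\sup_{x\in P}\langle x^*,x\rangle\}$ for some $x^*\in W^*$ (possibly $0$). $\mathcal{PL}(X,Y)$ is the set of $f:X\to Y$ such that $X$ is a finite union of polyhedra $P_i$ with $f=T_i+b_i$ on $P_i$ for some $T_i\in\mathcal{L}(X,Y)$,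 $b_i\in Y$. Efficiency. For $\Omega\subset Y$: $\mathrm{E}(\Omega,C)$ is the set of $\omega\in\Omega$ for which there is no $v\in\Omega\setminus\{\omega\}$ with $\omega-v\in C$; if $\mathrm{int}(C)\neq\emptyset$, $\mathrm{WE}(\Omega,C)$ is the set of $\omega\in\Omega$ for which there is no $v\in\Omega$ with $\omega-v\in\mathrm{int}(C)$. Setting. $X,Y$ are normed spaces, $C\subset Y$ is a closed convex cone, $f\in\mathcal{PL}(X,Y)$, $\varphi_1,\dots,\varphi_l\in\mathcal{PL}(X,\mathbb{R})$. Problem (PLP): $C$-Min $f(x)$ subject to $\varphi_j(x)\le0$, $j\in\overline{1l}$. Its feasible set is $A:=\{x\in X:\varphi_j(x)\le0\ \forall j\in\overline{1l}\}$; $S:=\{x\in A:f(x)\in\mathrm{E}(f(A),C)\}$ and $S^w:=\{x\in A:f(x)\in\mathrm{WE}(f(A),C)\}$. Fixed data: $T_i\in\mathcal{L}(X,Y)$, $u_{ik}^*,x_{ij}^*\in X^*$, $b_i\in Y$, $t_{ik},c_{ij}\in\mathbb{R}$ ($i\in\overline{1m}$, $k\in\overline{1q_i}$, $j\in\overline{1l}$) with $P_i=\{x\in X:\langle u_{ik}^*,x\rangle\le t_{ik}\ \forall k\in\overline{1q_i}\}$, $X=\bigcup_{i=1}^mP_i$, $\mathrm{int}(P_i)\neq\emptyset$, $P_i\cap\mathrm{int}(P_{i'})=\emptyset$ for $i\neq i'$, and $f=T_i+b_i$, $\varphi_j=x_{ij}^*-c_{ij}$ on $P_i$ for all $i,j$.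 For $i\in\overline{1m}$, $A_i:=\{x\in P_i:\langle x_{ij}^*,x\rangle\le c_{ij}\ \forall j\in\overline{1l}\}$, and the linear subproblem $(\mathrm{LP})_i$ is: $C$-min $T_ix+b_i$ subject to $x\in A_i$. Its Pareto (resp. weak Pareto) solutions are the $x\in A_i$ with $T_ix+b_i\in\mathrm{E}(T_i(A_i)+b_i,C)$ (resp. $\mathrm{WE}(T_i(A_i)+b_i,C)$). A Pareto (resp. weak Pareto) face of $(\mathrm{LP})_i$ is a face of $A_i$ all of whose points are Pareto (resp. weak Pareto) solutions of $(\mathrm{LP})_i$. *)

(* Defs.v *)
From mathcomp Require Import all_boot all_order all_algebra.
From mathcomp Require Import all_classical all_reals all_analysis.
Set Implicit Arguments.
Unset Strict Implicit.
Unset Printing Implicit Defensive.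
Import Order.TTheory GRing.Theory Num.Theory.
Import numFieldNormedType.Exports.
Local Open Scope classical_set_scope.
Local Open Scope ring_scope.

Section polyhedra.
Context {R : realType} {W : normedModType R}.
Implicit Types P F G : set W.

Definition ineq_set n (u : 'I_n -> {linear W -> R^o}) (s : 'I_n -> R) : set W :=
  [set x | forall k, u k x <= s k].

Definition strict_ineq_set n (v : 'I_n -> {linear W -> R^o}) (t : 'I_n -> R) :
    set W :=
  [set x | forall k, v k x < t k].

(* [n = 0] is allowed, so the whole space is a polyhedron. *)
Definition polyhedron P : Prop :=
  exists n (u : 'I_n -> {linear W -> R^o}) (s : 'I_n -> R),
    (forall k, continuous (u k)) /\ P = ineq_set u s.

Definition generalized_polyhedron G : Prop :=
  exists P n (v : 'I_n -> {linear W -> R^o}) (t : 'I_n -> R),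
    [/\ polyhedron P, forall k, continuous (v k) &
        G = P `&` strict_ineq_set v t].

(* Exposed face. The supremum is taken in the extended reals, as the default
   value of the real-valued [sup] on unbounded sets would be wrong here. *)
Definition face P F : Prop :=
  exists xs : {linear W -> R^o}, continuous xs /\
    F = [set w | P w /\ (xs w)%:E = ereal_sup [set (xs x)%:E | x in P]].

Definition cone (C : set W) : Prop :=
  C !=set0 /\ forall (a : R) y, 0 <= a -> C y -> C (a *: y).

End polyhedra.

Definition piecewise_linear {R : realType} {X Y : normedModType R}
    (f : X -> Y) : Prop :=
  exists m (P : 'I_m -> set X) (T : 'I_m -> {linear X -> Y}) (b : 'I_m -> Y),
    [/\ forall i, polyhedron (P i),
        [set: X] = \bigcup_i P i,
        forall i, continuous (T i) &
        forall i x, P i x -> f x = T i x + b i].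

Section efficiency.
Context {R : realType} {X Y : normedModType R}.
Implicit Types (Omega C : set Y) (A F : set X) (g : X -> Y).

Definition efficient Omega C : set Y :=
  [set w | Omega w /\ ~ exists v, [/\ Omega v, v <> w & C (w - v)]].

(* Only meaningful when [C] has nonempty interior. *)
Definition weakly_efficient Omega C : set Y :=
  [set w | Omega w /\ ~ exists v, Omega v /\ interior C (w - v)].

(* Solutions of: C-minimize [g x] subject to [x] in [A]. *)
Definition pareto_sol C g A : set X :=
  [set x | A x /\ efficient (g @` A) C (g x)].

Definition weak_pareto_sol C g A : set X :=
  [set x | A x /\ weakly_efficient (g @` A) C (g x)].

Definition pareto_face C g A F : Prop :=
  face A F /\ F `<=` pareto_sol C g A.

Definition weak_pareto_face C g A F : Prop :=
  face A F /\ F `<=` weak_pareto_sol C g A.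

End efficiency.

(* Main.v *)
(* For each piece [i], a feasible point [x] is a solution iff no piece [i']
   contains a [y] whose image dominates that of [x]. Fourier-Motzkin elimination
   of [y] works in infinite dimension, since only finitely many functionals
   occur, and turns each such condition into a finite union of polyhedra (of
   generalized polyhedra in the strong case). If [x] is a solution on the piece
   [i], so is every point of the face cut out by the constraints active at [x];
   intersecting with these finitely many faces gives the decomposition.

   When [C] is not pointed, [C] without 0 contains the nonzero elements of its
   lineality space, possibly of infinite dimension, which finitely many
   functionals cannot detect. However, if [T i] does not vanish on the common
   kernel of the constraints and of the functionals of [C] composed with [T i],
   then every point of the piece is dominated within the piece; and if it does,
   [T i] has finite rank. *)
Require Import Defs.
From mathcomp Require Import all_boot all_order all_algebra.
From mathcomp Require Import all_classical all_reals all_analysis.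
From mathcomp Require Import lra ring.
Set Implicit Arguments.
Unset Strict Implicit.
Unset Printing Implicit Defensive.
Import Order.TTheory GRing.Theory Num.Theory.
Import numFieldNormedType.Exports.
Local Open Scope classical_set_scope.
Local Open Scope ring_scope.

(** * Fourier-Motzkin elimination with weak and strict inequalities *)

Section fourier_motzkin.
Context {R : realFieldType}.

(** An index with [a i > 0] bounds [xi] above by [s i / a i], one with [a i < 0] bounds it below. A
    common [xi] exists as soon as each lower bound is below each upper one; the two may coincide
    only if both are weak. *)
Lemma eliminate_real (I : finType) (a s : I -> R) (c : I -> bool) :
  (exists xi, forall i, 0 < s i - xi * a i ?<= if c i) <->
  (forall i, a i = 0 -> 0 < s i ?<= if c i) /\
  (forall i j, 0 < a i -> a j < 0 ->
     0 < a i * s j - a j * s i ?<= if c i && c j).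
Proof.
split=> [[xi xiP]|[s0 sP]].
  split=> [i ai0|i j ai aj]; first by have := xiP i; rewrite ai0 mulr0 subr0.
  have := xiP i; have := xiP j; rewrite /Order.lteif.
  by case: (c i) (c j) => [] []/= ? ?; nra.
pose y i := s i / a i.
have sE i : a i != 0 -> s i = y i * a i by move=> ?; rewrite /y divfK.
have yP i j : 0 < a i -> a j < 0 -> y j < y i ?<= if c i && c j.
  move=> ai aj; have := sP _ _ ai aj.
  rewrite (sE i) ?gt_eqF// (sE j) ?lt_eqF//.
  have -> : a i * (y j * a j) - a j * (y i * a i) =
    - (a i * a j) * (y i - y j) by ring.
  have aij : 0 < - (a i * a j) by rewrite oppr_gt0 pmulr_rlt0.
  by rewrite /Order.lteif; case: ifP => _;
    rewrite ?pmulr_rge0 ?pmulr_rgt0 ?subr_ge0 ?subr_gt0.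
suff [xi xiP] : exists xi, forall i, (0 < a i -> xi < y i ?<= if c i) /\
    (a i < 0 -> y i < xi ?<= if c i).
  exists xi => i; have [ai|ai|ai] := ltgtP (a i) 0.
  - have := (xiP i).2 ai; rewrite (sE i) ?lt_eqF// /Order.lteif.
    by case: (c i) => ?; nra.
  - have := (xiP i).1 ai; rewrite (sE i) ?gt_eqF// /Order.lteif.
    by case: (c i) => ?; nra.
  - by rewrite ai mulr0 subr0; exact: s0.
(* If one kind of bound is missing, a point at distance 1 beyond the extremal bound of the other
   kind works; otherwise the midpoint between the least upper and the greatest lower bound does. *)
have [/existsP[u au]|noup] := boolP [exists i, 0 < a i]; last first.
  have {}noup i : 0 < a i -> False.
    by move=> ai; move/existsPn: noup => /(_ i); rewrite ai.
  have [/existsP[v av]|nolo] := boolP [exists i, a i < 0]; last first.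
    exists 0 => i; split=> ai; first by case: (noup i).
    by move/existsPn: nolo => /(_ i); rewrite ai.
  case: (@arg_maxP _ _ _ v (fun i => a i < 0) y av) => v' av' v'P.
  exists (y v' + 1) => i; split=> ai; first by case: (noup i).
  by have := v'P i ai; rewrite /Order.lteif /= ; case: (c i) => ?; lra.
case: (@arg_minP _ _ _ u (fun i => 0 < a i) y au) => u' au' u'P.
have [/existsP[v av]|nolo] := boolP [exists i, a i < 0]; last first.
  exists (y u' - 1) => i; split=> ai; last first.
    by move/existsPn: nolo => /(_ i); rewrite ai.
  by have := u'P i ai; rewrite /Order.lteif /= ; case: (c i) => ?; lra.
case: (@arg_maxP _ _ _ v (fun i => a i < 0) y av) => v' av' v'P.
exists ((y u' + y v') / 2) => i; split=> ai.
  have := u'P i ai; have := yP _ _ ai av'; rewrite /Order.lteif /=.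
  by case: (c i); case: (c v') => /= ? ?; lra.
have := v'P i ai; have := yP _ _ au' ai; rewrite /Order.lteif /=.
by case: (c i); case: (c u') => /= ? ?; lra.
Qed.

Context {V : lmodType R}.

Lemma functionalDZ (h : {linear V -> R^o}) x a y :
  h (x + a *: y) = h x + a * h y.
Proof. by rewrite linearD linearZ. Qed.

(** The recursion exposes one coefficient at a time, namely the variable to be eliminated in
    [fourier_motzkin]. *)
Fixpoint in_span (vs : seq V) (x : V) : Prop :=
  if vs is v :: vs' then exists xi, in_span vs' (x - xi *: v) else x = 0.

(** This replaces an infinite-dimensional unknown by finitely many coefficients. A vector is added
    only when the next functional is nonzero somewhere on the common kernel of the earlier ones: it
    then corrects the new value without disturbing the old ones. Otherwise the old values already
    determine the new one. *)
Lemma image_in_span (K : eqType) (beta : K -> {linear V -> R^o}) (ks : seq K) :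
  exists vs, forall x, exists2 y, in_span vs y &
    forall k, k \in ks -> beta k y = beta k x.
Proof.
elim: ks => [|k0 ks [vs vsP]]; first by exists [::] => x; exists 0.
have [[v [v0 vN0]]|nov] :=
    pselect (exists v, (forall k, k \in ks -> beta k v = 0) /\ beta k0 v != 0).
  exists (v :: vs) => x; have [y yvs yx] := vsP x.
  exists (y + (beta k0 (x - y) / beta k0 v) *: v).
    by exists (beta k0 (x - y) / beta k0 v); rewrite addrK.
  move=> k; rewrite inE functionalDZ => /orP[/eqP->|kks].
    by rewrite divfK// linearB /= addrC subrK.
  by rewrite (v0 k)// mulr0 addr0 yx.
exists vs => x; have [y yvs yx] := vsP x.
exists y => // k; rewrite inE => /orP[/eqP->|/yx//].
apply/eqP; rewrite -subr_eq0 -linearB; apply/negPn/negP => N.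
apply: nov; exists (y - x); split=> // k' k'ks.
by rewrite linearB /= yx// subrr.
Qed.

(* [c k] is true for a weak inequality and false for a strict one; an
   eliminated inequality that is weak only involves weak ones. *)
Lemma fourier_motzkin (K : finType) (beta : K -> {linear V -> R^o})
    (c : K -> bool) :
  exists (I : finType) (lam : I -> K -> R) (d : I -> bool),
    (forall i k, d i -> ~~ c k -> lam i k = 0) /\
    forall r : K -> R,
      (exists x, forall k, beta k x < r k ?<= if c k) <->
      (forall i, 0 < \sum_k lam i k * r k ?<= if d i).
Proof.
suff H vs : exists (I : finType) (lam : I -> K -> R) (d : I -> bool),
    (forall i k, d i -> ~~ c k -> lam i k = 0) /\
    forall r : K -> R,
      (exists x, in_span vs x /\ forall k, beta k x < r k ?<= if c k) <->
      (forall i, 0 < \sum_k lam i k * r k ?<= if d i).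
  have [vs vsP] := image_in_span beta (enum K).
  have [I [lam [d [dc E]]]] := H vs.
  exists I, lam, d; split=> // r; rewrite -E; split=> [[x xr]|[x [_ xr]]].
    have [y yvs yx] := vsP x; exists y; split=> // k.
    by rewrite yx ?mem_enum.
  by exists x.
elim: vs => [|v vs [I [lam [d [dc E]]]]].
  (* The empty span contains only 0, so the system reads [0 < r k], or [0 <= r k] for a weak [k]. *)
  exists K, (fun i k => (k == i)%:R), c; split=> [i k ci|r].
    by have [->|] := eqVneq k i; rewrite ?ci.
  have sumE i : \sum_k (k == i)%:R * r k = r i.
    rewrite (bigD1 i)//= eqxx mul1r big1 ?addr0// => k /negPf->.
    by rewrite mul0r.
  split=> [[x [/= -> xr]] i|rP]; first by rewrite sumE -(linear0 (beta i)).
  by exists 0; split=> // k; rewrite linear0 -sumE.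
pose a i := \sum_k lam i k * beta k v.
pose pr (ij : I * I) := (0 < a ij.1) && (a ij.2 < 0).
(* [inl i] keeps a row in which the coefficient of [v] vanishes, [inr (i, j)] combines a row of
   positive with a row of negative coefficient. All other indices carry the trivial row [0 <= 0]. *)
exists (I + I * I)%type,
  (fun z k => match z with
   | inl i => if a i == 0 then lam i k else 0
   | inr ij => if pr ij then a ij.1 * lam ij.2 k - a ij.2 * lam ij.1 k else 0
   end),
  (fun z => match z with
   | inl i => (a i == 0) ==> d i
   | inr ij => pr ij ==> d ij.1 && d ij.2
   end).
split=> [[i|ij] k|r].
- by case: ifP => //= _ di ck; exact: dc.
- by case: ifP => //= _ /andP[d1 d2] ck; rewrite !dc// !mulr0 subrr.
pose s i := \sum_k lam i k * r k.
have shiftE xi i : \sum_k lam i k * (r k - xi * beta k v) = s i - xi * a i.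
  rewrite /s /a mulr_sumr -sumrB; apply: eq_bigr => k _.
  by rewrite mulrBr mulrCA.
transitivity (exists xi, forall i, 0 < s i - xi * a i ?<= if d i).
  split=> [[x [[xi xvs] xr]]|[xi xiP]].
    exists xi => i; rewrite -shiftE; move: i; apply/E.
    exists (x - xi *: v); split=> // k.
    rewrite -scaleNr functionalDZ mulNr; have := xr k; rewrite /Order.lteif.
    by case: (c k); rewrite ?lerD2r ?ltrD2r.
  have /E[x [xvs xr]] : forall i,
      0 < \sum_k lam i k * (r k - xi * beta k v) ?<= if d i.
    by move=> i; rewrite shiftE.
  exists (x + xi *: v); split; first by exists xi; rewrite addrK.
  move=> k; rewrite functionalDZ; have := xr k; rewrite /Order.lteif.
  by case: (c k); rewrite ?lerBrDr ?ltrBrDr.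
rewrite eliminate_real; split=> [[s0 sP] [i|[i j]]|H].
- have [/s0|_] := eqVneq (a i) 0; first by [].
  by rewrite /= big1 ?lteifxx// => k _; rewrite mul0r.
- have [/andP[/= ai aj]|_] := boolP (pr (i, j)); last first.
    by rewrite /= big1 ?lteifxx// => k _; rewrite mul0r.
  have := sP i j ai aj; rewrite /s !mulr_sumr -sumrB /=.
  by congr (_ < _ ?<= if _); apply: eq_bigr => k _; ring.
split=> [i ai0|i j ai aj].
  by have := H (inl i); rewrite ai0 eqxx.
have := H (inr (i, j)); rewrite /pr /= ai aj /= /s !mulr_sumr -sumrB.
by congr (_ < _ ?<= if _); apply: eq_bigr => k _; ring.
Qed.

End fourier_motzkin.

(** * Finite-rank maps and vector equations as scalar equations *)

Section finite_rank.
Context {R : realFieldType} {V Y : lmodType R}.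

(** Induction on [n]: if some [v] is killed by all functionals but the first, the contribution of
    the first is subtracted from [F] along [v]; if there is none, the first vanishes wherever the
    others do and gets coefficient 0. Linearity of [F] is a hypothesis so that the corrected map can
    be passed to the induction. *)
Lemma factor_functionals n (w : 'I_n -> {linear V -> R^o}) (F : V -> Y) :
    (forall a x y, F (x + a *: y) = F x + a *: F y) ->
    (forall x, (forall k, w k x = 0) -> F x = 0) ->
  exists e : 'I_n -> Y, forall x, F x = \sum_k w k x *: e k.
Proof.
elim: n w F => [|n IH] w F Flin F0.
  by exists (fun=> 0) => x; rewrite big_ord0 F0// => -[].
pose w' (k : 'I_n) := w (lift ord0 k).
have [[v [v0 vN0]]|nov] :=
    pselect (exists v, (forall k, w' k v = 0) /\ w ord0 v != 0).
  have [||e eE] := IH w' (fun x => F x - (w ord0 x / w ord0 v) *: F v).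
  - move=> a x y; rewrite Flin functionalDZ mulrDl scalerDl opprD scalerBr.
    by rewrite scalerA mulrA addrACA.
  - move=> x x0; rewrite -scaleNr -Flin; apply: F0 => k.
    rewrite functionalDZ; have [j ->|->] := unliftP ord0 k.
      by rewrite -/(w' j) x0 v0 mulr0 addr0.
    by rewrite mulNr divfK// subrr.
  exists (fun k => if unlift ord0 k is Some j then e j
                   else (w ord0 v)^-1 *: F v) => x.
  rewrite big_ord_recl unlift_none scalerA.
  rewrite -[LHS](subrK ((w ord0 x / w ord0 v) *: F v)) eE addrC.
  by congr (_ + _); apply: eq_bigr => k _; rewrite liftK.
have [//||e eE] := IH w' F.
  move=> x x0; apply: F0 => k; have [j ->|->] := unliftP ord0 k; first exact: x0.
  by apply/eqP/negPn/negP => ?; apply: nov; exists x.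
exists (fun k => if unlift ord0 k is Some j then e j else 0) => x.
rewrite big_ord_recl unlift_none scaler0 add0r eE.
by apply: eq_bigr => k _; rewrite liftK.
Qed.

(* When one vector depends on the others, its coefficient is absorbed into
   theirs; otherwise it has to vanish by itself. *)
Lemma combination_eq0 (Z : Type) (L : set (Z -> R)) n
    (a : 'I_n -> Z -> R) (e : 'I_n -> Y) :
    (forall g h s, L g -> L h -> L (fun z => g z + s * h z)) ->
    (forall k, L (a k)) ->
  exists m (g : 'I_m -> Z -> R), (forall j, L (g j)) /\
    forall z, \sum_k a k z *: e k = 0 <-> forall j, g j z = 0.
Proof.
move=> LD; elim: n a e => [|n IH] a e La.
  exists 0%N, (fun _ _ => 0); split=> [[]//|z].
  by rewrite big_ord0; split=> // _ [].
pose a' (k : 'I_n) := a (lift ord0 k); pose e' (k : 'I_n) := e (lift ord0 k).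
have [[s sE]|noE] := pselect (exists s : 'I_n -> R, e ord0 = \sum_k s k *: e' k).
  have [|m [g [gL gE]]] := IH (fun k z => a' k z + s k * a ord0 z) e'.
    by move=> k; apply: LD; exact: La.
  exists m, g; split=> // z; rewrite -gE big_ord_recl sE scaler_sumr -big_split.
  rewrite (eq_bigr (fun k => (a' k z + s k * a ord0 z) *: e' k))// => k _.
  by rewrite /= scalerA -scalerDl addrC [s k * _]mulrC.
have [|m [g [gL gE]]] := IH a' e'; first by move=> k; exact: La.
exists m.+1, (fun j => if unlift ord0 j is Some i then g i else a ord0).
split=> [j|z]; first by case: unliftP => [i _|_] //; exact: gL.
rewrite big_ord_recl; split=> [az0|g0]; last first.
  have -> : a ord0 z = 0 by have := g0 ord0; rewrite unlift_none.
  rewrite scale0r add0r; apply/gE => j.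
  by have := g0 (lift ord0 j); rewrite liftK.
have a0 : a ord0 z = 0.
  apply/eqP/negPn/negP => aN0; apply: noE.
  exists (fun k => - (a ord0 z)^-1 * a' k z).
  under eq_bigr do rewrite -scalerA.
  rewrite -scaler_sumr scaleNr -scalerN; apply: (scalerI aN0).
  by rewrite scalerA divff// scale1r; apply/eqP; rewrite -addr_eq0 az0.
move: az0; rewrite a0 scale0r add0r => /gE g0 j.
by case: unliftP.
Qed.

End finite_rank.

(** * Finite unions of sets of a given class *)

Section finite_unions.
Context {W : Type}.
Implicit Types (Q : set (set W)) (D : set W).

Definition finite_union Q D :=
  exists p (F : 'I_p -> set W), (forall k, Q (F k)) /\ D = \bigcup_k F k.

Lemma finite_unionI Q (I : finType) (F : I -> set W) :
  (forall i, Q (F i)) -> finite_union Q (\bigcup_i F i).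
Proof.
move=> QF; exists #|I|, (F \o enum_val); split=> [k|]; first exact: QF.
apply/seteqP; split=> x [i _ Fx]; last by exists (enum_val i).
by exists (enum_rank i) => //=; rewrite enum_rankK.
Qed.

Lemma finite_union_ext Q D D' :
  (forall x, D x <-> D' x) -> finite_union Q D -> finite_union Q D'.
Proof. by move=> DD'; have -> : D = D' by apply/seteqP; split=> x /DD'. Qed.

Lemma finite_union1 Q D : Q D -> finite_union Q D.
Proof.
move=> QD; apply: finite_union_ext (finite_unionI (fun _ : unit => QD)) => x.
by split=> [[]//|]; exists tt.
Qed.

Lemma finite_union0 Q : finite_union Q set0.
Proof.
exists 0%N, (fun=> set0); split=> [[]//|].
by apply/seteqP; split=> x // [[]].
Qed.

Lemma finite_union_bigcup Q (J : finType) (D : J -> set W) :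
  (forall j, finite_union Q (D j)) -> finite_union Q (\bigcup_j D j).
Proof.
move=> /choice[p QD]; pose F j := projT1 (cid (QD j)).
have FP j : (forall k, Q (F j k)) /\ D j = \bigcup_k F j k :=
  projT2 (cid (QD j)).
apply: (finite_union_ext _ (@finite_unionI Q {j : J & 'I_(p j)}
  (fun z => F (tag z) (tagged z)) _)) => [x|z]; last by have [] := FP (tag z).
split=> [[[j k] _ Fx]|[j _]]; first by exists j => //; rewrite (FP j).2; exists k.
by rewrite (FP j).2 => -[k _ Fx]; exists (Tagged (fun j => 'I_(p j)) k).
Qed.

(** Two classes are allowed because the pieces of one factor may carry a property, such as lying in
    a solution face, that the intersection inherits from that factor alone. *)
Lemma finite_union_setI Q Q' D E : (forall A B, Q A -> Q' B -> Q' (A `&` B)) ->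
  finite_union Q D -> finite_union Q' E -> finite_union Q' (D `&` E).
Proof.
move=> QI [p [F [QF ->]]] [p' [F' [QF' ->]]].
apply: (finite_union_ext _ (@finite_unionI _ ('I_p * 'I_p')%type
  (fun z => F z.1 `&` F' z.2) _)) => [x|z]; last exact: QI.
split=> [[[k k'] _ [Fx F'x]]|[[k _ Fx] [k' _ F'x]]].
  by split; [exists k|exists k'].
by exists (k, k').
Qed.

Lemma finite_union_bigcap Q (J : finType) (D : J -> set W) : Q setT ->
  (forall A B, Q A -> Q B -> Q (A `&` B)) ->
  (forall j, finite_union Q (D j)) -> finite_union Q (\bigcap_j D j).
Proof.
move=> QT QI QD; suff H (s : seq J) :
    finite_union Q [set x | forall j, j \in s -> D j x].
  apply: finite_union_ext (H (enum J)) => x.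
  by split=> [Dx j _|Dx j _]; apply: Dx; rewrite ?mem_enum.
elim: s => [|j s IH].
  by apply: finite_union_ext (finite_union1 QT) => x.
apply: finite_union_ext (finite_union_setI QI (QD j) IH) => x; split.
  by move=> [Dx Ds] i; rewrite inE => /orP[/eqP->|/Ds].
by move=> Dx; split=> [|i si]; apply: Dx; rewrite inE ?eqxx// si orbT.
Qed.

End finite_unions.

(** * Affine functions, semipolyhedra and elimination of a variable *)

Section affine_functions.
Context {R : realType} {X : normedModType R}.

Definition affine (h : X -> R) :=
  exists (u : {linear X -> R^o}) s, continuous u /\ forall x, h x = u x + s.

(** Jointly affine in the pair; the linear parts are kept apart so that [y] can be eliminated while
    [x] stays a parameter. *)
Definition biaffine (z : X * X -> R) :=
  exists (u v : {linear X -> R^o}) s, [/\ continuous u, continuous v &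
    forall x y, z (x, y) = u x + v y + s].

Lemma affine_cst s : affine (fun=> s).
Proof.
exists (\0 : {linear X -> R^o}), s; split=> [|x]; last by rewrite /= add0r.
by move=> x; exact: cvg_cst.
Qed.

Lemma affineDZ a g h : affine g -> affine h -> affine (fun x => g x + a * h x).
Proof.
move=> [u [s [uc uE]]] [v [t [vc vE]]].
exists (u \+ a \*: v : {linear X -> R^o}), (s + a * t); split=> [x|x].
  by apply: cvgD; [exact: uc|apply: cvgZl_tmp; exact: vc].
by rewrite uE vE /= /GRing.scale /=; ring.
Qed.

Lemma affine_sum (K : Type) (ks : seq K) (a : K -> R) (h : K -> X -> R) :
  (forall k, affine (h k)) -> affine (fun x => \sum_(k <- ks) a k * h k x).
Proof.
move=> ah; elim: ks => [|k ks IH].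
  have -> : (fun x => \sum_(k <- [::]) a k * h k x) = (fun=> 0).
    by apply/funext => x; rewrite big_nil.
  exact: affine_cst.
have -> : (fun x => \sum_(i <- k :: ks) a i * h i x) =
    (fun x => \sum_(i <- ks) a i * h i x + a k * h k x).
  by apply/funext => x; rewrite big_cons addrC.
exact: affineDZ.
Qed.

Lemma biaffine_l g : affine g -> biaffine (fun z => g z.1).
Proof.
move=> [u [s [uc uE]]]; exists u, (\0 : {linear X -> R^o}), s; split=> // [x|x y].
  exact: cvg_cst.
by rewrite /= uE addr0.
Qed.

Lemma biaffine_r g : affine g -> biaffine (fun z => g z.2).
Proof.
move=> [u [s [uc uE]]]; exists (\0 : {linear X -> R^o}), u, s; split=> // [x|x y].
  exact: cvg_cst.
by rewrite /= uE add0r.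
Qed.

Lemma biaffineDZ a g h : biaffine g -> biaffine h ->
  biaffine (fun z => g z + a * h z).
Proof.
move=> [u [v [s [uc vc E]]]] [u' [v' [s' [uc' vc' E']]]].
exists (u \+ a \*: u' : {linear X -> R^o}), (v \+ a \*: v' : {linear X -> R^o}).
exists (s + a * s'); split=> [x|x|x y].
- by apply: cvgD; [exact: uc|apply: cvgZl_tmp; exact: uc'].
- by apply: cvgD; [exact: vc|apply: cvgZl_tmp; exact: vc'].
by rewrite E E' /= /GRing.scale /=; ring.
Qed.

(* [w] asks for weak inequalities only: then this is a polyhedron, and
   otherwise a generalized polyhedron. *)
Definition semipolyhedron (w : bool) (P : set X) :=
  exists (I : finType) (h : I -> X -> R) (c : I -> bool),
    [/\ forall i, affine (h i), w -> forall i, c i &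
        P = [set x | forall i, h i x < 0 ?<= if c i]].

Lemma affine_weak_polyhedron (I : finType) (h : I -> X -> R) :
  (forall i, affine (h i)) -> polyhedron [set x | forall i, h i x <= 0].
Proof.
move=> /choice[u /choice[s uE]]; exists #|I|, (u \o enum_val).
exists (fun k => - s (enum_val k)); split=> [k|]; first exact: (uE _).1.
apply/seteqP; split=> x hx k.
  by have := hx (enum_val k); rewrite (uE _).2 /=; lra.
by have := hx (enum_rank k); rewrite /= enum_rankK (uE _).2; lra.
Qed.

Lemma semipolyhedron_polyhedron P : semipolyhedron true P -> polyhedron P.
Proof.
move=> [I [h [c [ah ct ->]]]].
have -> : c = (fun=> true) by apply/funext => i; exact: ct.
exact: affine_weak_polyhedron.
Qed.

Lemma semipolyhedron_generalized w P :
  semipolyhedron w P -> generalized_polyhedron P.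
Proof.
move=> [I [h [c [ah _ ->]]]].
have /choice[u /choice[s uE]] := ah.
pose J := {i : I | ~~ c i}; pose e (k : 'I_#|{: J}|) := val (enum_val k).
exists [set x | forall i : {i : I | c i}, h (val i) x <= 0], _,
  (u \o e), (fun k => - s (e k)).
split; [by apply: affine_weak_polyhedron => i; exact: ah
       |by move=> k; exact: (uE _).1|].
apply/seteqP; split=> x hx.
  split=> [[i ci]|k] /=; first by have := hx i; rewrite ci.
  by have := hx (e k); rewrite (negPf (valP (enum_val k))) /= (uE _).2; lra.
move=> i; case: (boolP (c i)) => ci; first exact: (hx.1 (exist _ i ci)).
have := hx.2 (enum_rank (exist _ i ci : J)).
by rewrite /= /e enum_rankK /= (uE _).2; lra.
Qed.

Lemma semipolyhedronI w P Q :
  semipolyhedron w P -> semipolyhedron w Q -> semipolyhedron w (P `&` Q).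
Proof.
move=> [I [h [c [ah cw ->]]]] [I' [h' [c' [ah' cw' ->]]]].
exists (I + I')%type, (fun z => match z with inl i => h i | inr i => h' i end),
  (fun z => match z with inl i => c i | inr i => c' i end).
split=> [[i|i]|wt [i|i]|]; rewrite ?ah ?ah' ?cw ?cw'//.
apply/seteqP; split=> [x [hx h'x] [i|i]|x hx]; [exact: hx|exact: h'x|].
by split=> i; [exact: (hx (inl i))|exact: (hx (inr i))].
Qed.

Lemma semipolyhedron_cst w (p : Prop) : semipolyhedron w [set _ : X | p].
Proof.
exists unit, (fun _ _ => if `[< p >] then 0 else 1), (fun=> true).
split=> // [_|]; first exact: affine_cst.
apply/seteqP; split=> x /= px; first by rewrite asboolT.
by have := px tt; case: asboolP => //=; rewrite ler10.
Qed.

Lemma semipolyhedronT w : semipolyhedron w [set: X].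
Proof. exact: (@semipolyhedron_cst w True). Qed.

(** Eliminating [y] turns solvability into finitely many rows in [x], and unsolvability is the union
    of their negations. Negating a strict row gives a weak one. A weak row would give a strict one,
    but it only combines weak constraints; if [w] holds these do not vary with [x], so the row is a
    constant condition. *)
Lemma finite_union_unsolvable (w : bool) (K : finType) (h : K -> X * X -> R)
    (c : K -> bool) : (forall k, biaffine (h k)) ->
  (w -> forall k x x' y, c k -> h k (x, y) = h k (x', y)) ->
  finite_union (semipolyhedron w)
    [set x | ~ exists y, forall k, h k (x, y) < 0 ?<= if c k].
Proof.
move=> /choice[al /choice[be /choice[s hE]]] hw.
have [I [lam [d [dc FM]]]] := fourier_motzkin be c.
pose r x k := - (al k x + s k).
have rP x : (exists y, forall k, h k (x, y) < 0 ?<= if c k) <->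
    forall i, 0 < \sum_k lam i k * r x k ?<= if d i.
  rewrite -FM; split=> -[y yP]; exists y => k; have := yP k; have [_ _ ->] := hE k;
  by rewrite /r /Order.lteif; case: (c k) => ?; lra.
apply: (finite_union_ext _ (@finite_unionI _ _ I (fun i =>
    [set x | \sum_k lam i k * r x k < 0 ?<= if ~~ d i]) _)) => [x|i].
  split=> [[i _ /= ix] /rP/(_ i)|nx]; first by rewrite lteifNE in ix; exact/negP.
  apply: contrapT => nex; apply/nx/rP => i.
  apply: contrapT => /negP ni; apply: nex; exists i => //=.
  by rewrite lteifNE.
have ra k : affine (fun x => r x k).
  have [uc _ _] := hE k; rewrite /r.
  have : affine (fun x => 0 + (- 1) * (al k x + s k)).
    by apply: affineDZ; [exact: affine_cst|exists (al k), (s k)].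
  by congr affine; apply/funext => x; rewrite add0r mulN1r.
have [/andP[wt di]|ndi] := boolP (w && d i).
  have rc x : \sum_k lam i k * r x k = \sum_k lam i k * r 0 k.
    apply: eq_bigr => k _; have [ck|ck] := boolP (c k); last by rewrite dc ?mul0r.
    have := hw wt k x 0 0 ck; have [_ _ hkE] := hE k; rewrite !hkE /r linear0 => ?.
    by congr (_ * _); lra.
  under [X in semipolyhedron _ X]eq_set do rewrite rc.
  exact: semipolyhedron_cst.
exists unit, (fun _ x => \sum_k lam i k * r x k), (fun=> ~~ d i).
split=> [_|wt _|].
- exact: affine_sum.
- by move: ndi; rewrite wt.
- by apply/seteqP; split=> x; [move=> ? _|move=> /(_ tt)].
Qed.

End affine_functions.

(** * Faces given by active constraints, and undominated points on them *)

Section faces.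
Context {R : realType} {X Y : normedModType R}.
Context {K : finType} (V : K -> {linear X -> R^o}) (r : K -> R).

Definition weak_ineq_set : set X := [set x | forall k, V k x <= r k].

Definition tight_set (I : {set K}) : set X :=
  weak_ineq_set `&` [set x | forall k, k \in I -> V k x = r k].

Definition tight_indices (x : X) : {set K} := [set k | V k x == r k]%SET.

Lemma tight_indicesP x : weak_ineq_set x -> tight_set (tight_indices x) x.
Proof. by move=> Ax; split=> // k; rewrite inE => /eqP. Qed.

Context (V_cont : forall k, continuous (V k)).

Lemma affine_functional k a : affine (fun x => V k x + a).
Proof. by exists (V k), a. Qed.

Lemma semipolyhedron_tight w I : semipolyhedron w (tight_set I).
Proof.
exists (K + K)%type, (fun z => match z with
  | inl k => fun x => V k x + - r k
  | inr k => if k \in I then fun x => r k + - 1 * (V k x + 0) else fun=> 0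
  end), (fun=> true).
split=> // [[k|k]|]; first exact: affine_functional.
  case: ifP => _; last exact: affine_cst.
  by apply: affineDZ; [exact: affine_cst|exact: affine_functional].
apply/seteqP; split=> x /=; last first.
  move=> h; have Ax : weak_ineq_set x by move=> k; have := h (inl k); lra.
  split=> // k kI; have := Ax k; have := h (inr k); rewrite kI; lra.
move=> [Ax Ix] [k|k]; first by have := Ax k; lra.
by case: ifP => // /Ix ->; lra.
Qed.

(* The sum of the tight functionals exposes the face. *)
Lemma tight_set_face I : tight_set I !=set0 -> face weak_ineq_set (tight_set I).
Proof.
move=> [x0 [Ax0 Ix0]].
have [u [s [uc uE]]] : affine (fun x => \sum_k (k \in I)%:R * V k x).
  by apply: affine_sum => k; exists (V k), 0; split=> // x; rewrite addr0.
have diffE x : u x0 - u x = \sum_k (k \in I)%:R * (r k - V k x).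
  transitivity (\sum_k (k \in I)%:R * V k x0 - \sum_k (k \in I)%:R * V k x).
    by rewrite !uE; lra.
  rewrite -sumrB; apply: eq_bigr => k _; rewrite -mulrBr.
  by have [/Ix0->//|] := boolP (k \in I); rewrite !mul0r.
have term_ge0 x : weak_ineq_set x ->
    forall k, true -> 0 <= (k \in I)%:R * (r k - V k x).
  by move=> Ax k _; rewrite mulr_ge0// subr_ge0.
(* [u x0 - u x] is the sum of the slacks of [I], all nonnegative on the set, so it vanishes only if
   each of them does. *)
have -> : tight_set I = [set x | weak_ineq_set x /\ u x = u x0].
  apply/seteqP; split=> x [Ax Ix]; split=> //.
    apply/eqP; rewrite eq_sym -subr_eq0 diffE big1// => k _.
    by have [/Ix->|] := boolP (k \in I); rewrite ?subrr ?mulr0 ?mul0r.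
  move=> k kI; have := diffE x; rewrite Ix subrr => /esym.
  move=> /(psumr_eq0P (term_ge0 x Ax))/(_ k isT).
  by rewrite kI mul1r => /eqP; rewrite subr_eq0 => /eqP.
exists u; split=> //.
have -> : ereal_sup [set (u x)%:E | x in weak_ineq_set] = (u x0)%:E.
  apply/eqP; rewrite eq_le; apply/andP; split.
    apply: ge_ereal_sup => _ [x Ax <-]; rewrite lee_fin -subr_ge0 diffE.
    by apply: sumr_ge0; exact: term_ge0.
  by apply: ereal_sup_ubound; exists x0.
by apply/seteqP; split=> x [Ax /= ux]; split=> //=; [rewrite ux|case: ux].
Qed.

(* [D] is the set of dominating directions: [interior C] for weak efficiency
   and [C] without 0 for efficiency. *)
Definition undominated (D : set Y) (g : X -> Y) (A : set X) : set X :=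
  [set x | A x /\ ~ exists y, A y /\ D (g x - g y)].

(* If [y] in the face were dominated by [y'], then [x + e (y' - y)] would
   dominate [x] for small [e]. *)
Lemma undominated_tight (D : set Y) (T : {linear X -> Y}) b x :
    (forall a y, 0 < a -> D y -> D (a *: y)) ->
  undominated D (fun x => T x + b) weak_ineq_set x ->
  tight_set (tight_indices x) `<=` undominated D (fun x => T x + b) weak_ineq_set.
Proof.
move=> DZ [Ax ndx] y [Ay Iy]; split=> // -[y' [Ay' Dyy']]; apply: ndx.
pose d k := V k y' - V k y; pose sl k := r k - V k x.
(* [M] exceeds each ratio of change to slack, so a step of [M^-1] uses up no positive slack.
   Constraints active at [x] have zero slack and contribute 0, division by 0 being 0; they are also
   active at [y], so there [d k <= 0]. *)
pose M := 1 + \sum_k `|d k| / sl k.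
have term_ge0 k : 0 <= `|d k| / sl k by rewrite divr_ge0// subr_ge0.
have M0 : 0 < M by rewrite ltr_pwDl// sumr_ge0.
exists (x + M^-1 *: (y' - y)); split=> [k|]; last first.
  have -> : T x + b - (T (x + M^-1 *: (y' - y)) + b) =
      M^-1 *: (T y + b - (T y' + b)).
    rewrite [T (x + _)]linearD [T (_ *: _)]linearZ [T (y' - y)]linearB /=.
    rewrite [X in _ - X = _]addrAC opprD addrA subrr add0r -scalerN opprB.
    by congr (_ *: _); rewrite opprD addrACA subrr addr0.
  by apply: DZ => //; rewrite invr_gt0.
rewrite functionalDZ linearB /= -/(d k).
have [kI|kI] := boolP (k \in tight_indices x).
  have := kI; rewrite inE => /eqP->; rewrite gerDl pmulr_rle0 ?invr_gt0//.
  by rewrite subr_le0 Iy.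
have sl0 : 0 < sl k by rewrite subr_gt0 lt_neqAle Ax andbT; rewrite inE in kI.
rewrite -lerBrDl -/(sl k) mulrC ler_pdivrMr//.
apply: (le_trans (ler_norm _)); rewrite mulrC -ler_pdivrMr//.
rewrite /M (bigD1 k)//= addrCA lerDl addr_ge0// sumr_ge0//.
Qed.

End faces.

(** * Polyhedral cones and their interiors *)

Section cones.
Context {R : realType} {Y : normedModType R}.
Implicit Types C : set Y.

Lemma polyhedral_cone C : cone C -> polyhedron C ->
  exists n (g : 'I_n -> {linear Y -> R^o}), (forall j, continuous (g j)) /\
    C = [set y | forall j, g j y <= 0].
Proof.
move=> [[y0 Cy0] CZ] [n [g [s [gc CE]]]]; exists n, g; split=> //.
have C0 : C 0 by rewrite -(scale0r y0); exact: CZ.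
rewrite CE; apply/seteqP; split=> y yP j; last first.
  apply: le_trans (yP j) _; move: C0; rewrite CE => /(_ j).
  by rewrite linear0.
rewrite leNgt; apply/negP => gy0.
have Cy : C y by rewrite CE.
have s0 : 0 <= s j by move: C0; rewrite CE => /(_ j); rewrite linear0.
(* This scaling gives the functional the value [s j + 1], which violates its bound. *)
have := CZ ((s j + 1) / g j y) y; rewrite CE => /(_ _ yP j).
rewrite linearZ /= /GRing.scale /= divfK ?gt_eqF//.
by move=> /(_ (divr_ge0 (addr_ge0 s0 ler01) (ltW gy0))); rewrite leNgt ltrDl ltr01.
Qed.

Lemma interior_shift (C : set Y) y v : interior C y ->
  exists2 e : R, 0 < e & C (y + e *: v).
Proof.
move=> Cy; have cv : (y + e *: v) @[e --> (0 : R)] --> y + 0 *: v.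
  by apply: cvgD; [exact: cvg_cst|apply: cvgZr_tmp; exact: cvg_id].
rewrite scale0r addr0 in cv.
have [e /= e0 eC] := cv _ Cy.
exists (e / 2); first by rewrite divr_gt0.
apply: eC; rewrite /ball_ /= sub0r normrN gtr0_norm ?divr_gt0//.
by rewrite ltr_pdivrMr// ltr_pMr// ltr1n.
Qed.

(** A functional that is nowhere positive is zero: its weak inequality always holds, its strict one
    never, so it is dropped. Any other one increases along some direction and must be negative at an
    interior point. *)
Lemma interior_polyhedral_cone n (g : 'I_n -> {linear Y -> R^o}) :
    (forall j, continuous (g j)) ->
  exists (J : finType) (g' : J -> {linear Y -> R^o}),
    (forall j, continuous (g' j)) /\
    interior [set y | forall j, g j y <= 0] = [set y | forall j, g' j y < 0].
Proof.
move=> gc; exists {j | `[< exists v, 0 < g j v >]}, (fun j => g (val j)).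
split=> [j|]; first exact: gc.
apply/seteqP; split=> y yP.
  move=> [j jP]; have [v gv] := asboolP _ jP.
  have [e e0 /(_ j)] := interior_shift v yP.
  rewrite functionalDZ /=; have : 0 < e * g j v by rewrite mulr_gt0.
  by move=> *; lra.
have H : \forall z \near y,
    forall j : {j | `[< exists v, 0 < g j v >]}, g (val j) z < 0.
  apply: filter_forall => j; apply: cvgr_lt (yP j); exact: gc.
apply: filterS H => z zP j; have [v|nv] := pselect (exists v, 0 < g j v).
  by apply: ltW; apply: (zP (exist _ j _)); apply/asboolP.
by rewrite leNgt; apply/negP => gz; apply: nv; exists z.
Qed.

End cones.

(** * Solutions as undominated points *)

Section solutions.
Context {R : realType} {X Y : normedModType R}.

Lemma pareto_solE (C : set Y) (g : X -> Y) A :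
  pareto_sol C g A = undominated (C `\ 0) g A.
Proof.
apply/seteqP; split=> x [Ax].
  move=> [_ nd]; split=> // -[y [Ay [Cxy /eqP xy0]]]; apply: nd.
  exists (g y); split=> //.
  by move=> e; move: xy0; rewrite e subrr eqxx.
move=> nd; split=> //; split; first by exists x.
move=> [_ [[y Ay <-] yx Cxy]]; apply: nd; exists y; split=> //; split=> //.
by move=> /eqP; rewrite subr_eq0 => /eqP e; apply: yx.
Qed.

Lemma weak_pareto_solE (C : set Y) (g : X -> Y) A :
  weak_pareto_sol C g A = undominated (interior C) g A.
Proof.
apply/seteqP; split=> x [Ax].
  move=> [_ nd]; split=> // -[y [Ay Cxy]]; apply: nd.
  by exists (g y).
move=> nd; split=> //; split; first by exists x.
by move=> [_ [[y Ay <-] Cxy]]; apply: nd; exists y.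
Qed.

End solutions.

Lemma sum_enum_val {V : nmodType} (K : finType) (F : K -> V) :
  \sum_k F k = \sum_(i < #|K|) F (enum_val i).
Proof. by rewrite -(big_enum_val (A := K)); apply: eq_bigl => k. Qed.

Lemma combination_eq0_fin {R : realFieldType} {Y : lmodType R} (Z : Type)
    (L : set (Z -> R)) (K : finType) (a : K -> Z -> R) (e : K -> Y) :
    (forall g h s, L g -> L h -> L (fun z => g z + s * h z)) ->
    (forall k, L (a k)) ->
  exists m (g : 'I_m -> Z -> R), (forall j, L (g j)) /\
    forall z, \sum_k a k z *: e k = 0 <-> forall j, g j z = 0.
Proof.
move=> LD La; have [m [g [gL gE]]] :=
  combination_eq0 (e \o enum_val) LD (fun k => La (@enum_val K K k)).
by exists m, g; split=> // z; rewrite sum_enum_val -gE.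
Qed.

(** * Undominated points of a piecewise affine map *)

Section pieces.
Context {R : realType} {X Y : normedModType R}.
Context {m : nat} {K : 'I_m -> finType}.
Context (V : forall i, K i -> {linear X -> R^o}) (r : forall i, K i -> R).
Context (T : 'I_m -> {linear X -> Y}) (b : 'I_m -> Y).
Context (V_cont : forall i k, continuous (V (i := i) k)).
Context (T_cont : forall i, continuous (T i)).
Let A_ i := weak_ineq_set (V (i := i)) (r (i := i)).
Let f_ i x := T i x + b i.

(** The constraints of [A_ i'] are weak but involve only [y], so only the constraints [h] coupling
    [x] and [y] must be strict when [w] holds. *)
Lemma unsolvable_on_piece (w : bool) i' (J : finType) (h : J -> X * X -> R)
    (c : J -> bool) :
  (forall j, biaffine (h j)) -> (w -> forall j, ~~ c j) ->
  finite_union (semipolyhedron w)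
    [set x | ~ exists y, A_ i' y /\ forall j, h j (x, y) < 0 ?<= if c j].
Proof.
move=> hb cw; apply: finite_union_ext
  (@finite_union_unsolvable _ _ w (K i' + J)%type
  (fun s => match s with
   | inl k => fun z => V k z.2 + - r k | inr j => h j end)
  (fun s => if s is inr j then c j else true) _ _) => [x|[k|j]|wt [k|j] x x' y cj].
- split=> nex [y yP]; apply: nex; exists y.
    by move=> [k|j] /=; [rewrite subr_le0; exact: yP.1|exact: yP.2].
  by split=> [k|j]; [have := yP (inl k); rewrite /= subr_le0|exact: (yP (inr j))].
- exact: (biaffine_r (affine_functional (@V_cont i') k (- r k))).
- exact: hb.
- by [].
- by have := cw wt j; rewrite cj.
Qed.

Lemma biaffine_difference (g : {linear Y -> R^o}) i i' : continuous g ->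
  biaffine (fun z => g (f_ i z.1 - f_ i' z.2)).
Proof.
move=> gc.
have ga i0 : affine (fun x => g (f_ i0 x)).
  exists (g \o T i0 : {linear X -> R^o}), (g (b i0)); split=> [x|x].
    by apply: continuous_comp; [exact: T_cont|exact: gc].
  by rewrite /f_ linearD.
have -> : (fun z => g (f_ i z.1 - f_ i' z.2)) =
    (fun z : X * X => g (f_ i z.1) + -1 * g (f_ i' z.2)).
  by apply/funext => z; rewrite linearB mulN1r.
by apply: biaffineDZ; [exact: (biaffine_l (ga i))|exact: (biaffine_r (ga i'))].
Qed.

Lemma biaffineZ a (h : X * X -> R) : biaffine h -> biaffine (fun z => a * h z).
Proof.
move=> hb; have -> : (fun z => a * h z) = (fun z => 0 + a * h z).
  by apply/funext => z; rewrite add0r.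
by apply: biaffineDZ => //; exact: (biaffine_l (affine_cst 0)).
Qed.

(** * Decomposition along faces of the pieces *)

Section pieces_of_undominated.
Context (D : set Y) (f : X -> Y) (A : set X).
Context (A_pieces : A = \bigcup_i A_ i).
Context (f_pieces : forall i x, A_ i x -> f x = f_ i x).

Lemma undominated_piecesE i x : A_ i x ->
  undominated D f A x <-> forall i', ~ exists y, A_ i' y /\ D (f_ i x - f_ i' y).
Proof.
move=> Ax; split=> [[_ nd] i' [y [Ay Dy]]|nd].
  apply: nd; exists y; rewrite (f_pieces Ax) (f_pieces Ay); split=> //.
  by rewrite A_pieces; exists i'.
split; first by rewrite A_pieces; exists i.
rewrite A_pieces => -[y [[i' _ Ay] Dy]]; apply: (nd i'); exists y.
by rewrite -(f_pieces Ax) -(f_pieces Ay).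
Qed.

(** [B] needs to describe the solutions only on [A_ i], since it gets intersected with faces of that
    piece. *)
Lemma undominated_decomposition (w : bool) :
    (forall a y, 0 < a -> D y -> D (a *: y)) ->
    (forall i, exists2 B, finite_union (semipolyhedron w) B &
       forall x, A_ i x -> B x <-> undominated D f A x) ->
  finite_union (fun F => semipolyhedron w F /\ exists i G,
      [/\ face (A_ i) G, G `<=` undominated D (f_ i) (A_ i) & F `<=` G])
    (undominated D f A).
Proof.
move=> DZ HB.
pose t (z : {i : 'I_m & {set K i}}) :=
  tight_set (V (i := tag z)) (r (i := tag z)) (tagged z).
(* An index [z] is a piece with a set of active constraints. Whether its face consists of subproblem
   solutions does not depend on [x], so bad indices simply contribute the empty union. *)
pose ok z := t z !=set0 /\ t z `<=` undominated D (f_ (tag z)) (A_ (tag z)).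
apply: (finite_union_ext _ (@finite_union_bigcup _ _ _
  (fun z => [set x | [/\ ok z, t z x & undominated D f A x]]) _)) => [x|z].
  split=> [[z _ []]//|Sx].
  have [i _ Ax] : (\bigcup_i A_ i) x by rewrite -A_pieces; case: Sx.
  exists (Tagged (fun i => {set K i})
    (tight_indices (V (i := i)) (r (i := i)) x)) => //.
  have tx := tight_indicesP Ax.
  split=> //; split; first by exists x.
  (* A solution of the whole problem also solves the subproblem of its own piece, hence so does
     every point of its active face. *)
  apply: undominated_tight => //; split=> // -[y [Ay Dy]].
  by apply: (proj1 (undominated_piecesE Ax) Sx i); exists y.
have [okz|nok] := pselect (ok z); last first.
  by apply: finite_union_ext (finite_union0 _) => x; split=> // -[].
have [B BQ BE] := HB (tag z).
have tz : finite_union (fun F => semipolyhedron w F /\ exists i G,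
    [/\ face (A_ i) G, G `<=` undominated D (f_ i) (A_ i) & F `<=` G]) (t z).
  apply: finite_union1; split; first exact: semipolyhedron_tight.
  exists (tag z), (t z); split=> //; last exact: okz.2.
  exact: tight_set_face okz.1.
apply: finite_union_ext (finite_union_setI _ BQ tz)
    => [x|P Q Pw [Qw [i [G [Gf Gd QG]]]]].
  split=> [[Bx tx]|[_ tx Sx]]; last by split=> //; apply/BE => //; exact: tx.1.
  by split=> //; apply/BE => //; exact: tx.1.
split; first exact: semipolyhedronI.
by exists i, G; split=> // x [_ /QG].
Qed.

End pieces_of_undominated.

(** Domination is expressed by strict inequalities alone, so its negation yields weak ones, hence
    [semipolyhedron true]. *)
Lemma open_cone_region (J : finType) (g : J -> {linear Y -> R^o}) f A i :
    (forall j, continuous (g j)) ->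
    A = \bigcup_i A_ i -> (forall i x, A_ i x -> f x = f_ i x) ->
  exists2 B, finite_union (semipolyhedron true) B &
    forall x, A_ i x -> B x <-> undominated [set y | forall j, g j y < 0] f A x.
Proof.
move=> gc Ap fp.
exists (\bigcap_i' [set x | ~ exists y, A_ i' y /\
    forall j, g j (f_ i x - f_ i' y) < 0 ?<= if false]).
  apply: finite_union_bigcap => [|P Q|i'].
  - exact: semipolyhedronT.
  - exact: semipolyhedronI.
  - apply: (@unsolvable_on_piece true i' J
      (fun j z => g j (f_ i z.1 - f_ i' z.2))) => // j.
    exact: biaffine_difference.
by move=> x Ax; rewrite undominated_piecesE//; split=> H i' => [|_]; exact: H.
Qed.

(** * The closed cone without 0, including its lineality space *)

Section closed_cone.
Context {n : nat} (g : 'I_n -> {linear Y -> R^o}).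
Context (g_cont : forall j, continuous (g j)).

(** If this fails, some [h] can be added to any point without changing the constraint values, while
    the image moves by a nonzero vector of the lineality space of the cone. *)
Definition determined i := forall h, (forall k, V (i := i) k h = 0) ->
  (forall j, g j (T i h) = 0) -> T i h = 0.

Lemma determined_finite_rank i : determined i ->
  exists N (w : 'I_N -> {linear X -> R^o}) (e : 'I_N -> Y),
    (forall k, continuous (w k)) /\ forall x, T i x = \sum_k w k x *: e k.
Proof.
move=> di; pose w (k : 'I_#|{: K i + 'I_n}|) : {linear X -> R^o} :=
  match enum_val k with inl k => V k | inr j => g j \o T i end.
have wE s : w (enum_rank s) =
    match s with inl k => V k | inr j => g j \o T i end.
  by rewrite /w enum_rankK.
have [||e eE] := @factor_functionals _ _ _ _ w (T i).
- by move=> a x y; rewrite linearD linearZ.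
- move=> x x0; apply: di => [k|j].
    by have := x0 (enum_rank (inl k)); rewrite wE.
  by have := x0 (enum_rank (inr j)); rewrite wE.
exists _, w, e; split=> // k; rewrite /w; case: (enum_val k) => [k'|j x].
  exact: V_cont.
by apply: continuous_comp; [exact: T_cont|exact: g_cont].
Qed.

(** Both maps have finite rank, so the difference is a combination of finitely many fixed vectors
    with biaffine coefficients, [b i - b i'] having coefficient 1. [combination_eq0_fin] turns its
    vanishing into scalar equations. *)
Lemma determined_difference i i' : determined i -> determined i' ->
  exists p (gam : 'I_p -> X * X -> R), (forall j, biaffine (gam j)) /\
    forall x y, f_ i x = f_ i' y <-> forall j, gam j (x, y) = 0.
Proof.
move=> /determined_finite_rank[N [w [e [wc wE]]]].
move=> /determined_finite_rank[N' [w' [e' [wc' wE']]]].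
have [||p [gam [gb gE]]] := @combination_eq0_fin R Y (X * X)%type biaffine
  ('I_1 + ('I_N + 'I_N'))%type
  (fun k => match k with
   | inl _ => fun=> 1
   | inr (inl k) => fun z => w k z.1
   | inr (inr k) => fun z => -1 * w' k z.2
   end)
  (fun k => match k with
   | inl _ => b i - b i' | inr (inl k) => e k | inr (inr k) => e' k end).
- by move=> g' h s; exact: biaffineDZ.
- move=> [_|[k|k]].
  + exact: (biaffine_l (affine_cst 1)).
  + by apply: biaffine_l; exists (w k), 0; split=> // x; rewrite addr0.
  + apply/biaffineZ/biaffine_r; exists (w' k), 0.
    by split=> // x; rewrite addr0.
exists p, gam; split=> // x y; rewrite -gE !big_sumType big_ord1 /= scale1r.
rewrite -wE; under [X in _ + (_ + X)]eq_bigr do rewrite mulN1r scaleNr.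
rewrite sumrN -wE' /f_.
have -> : b i - b i' + (T i x - T i' y) = T i x + b i - (T i' y + b i').
  by rewrite opprD [RHS]addrACA addrC.
by split=> [->|/eqP]; rewrite ?subrr// subr_eq0 => /eqP.
Qed.

(** This describes the [x] not dominated from piece [i'] through a nonzero lineality vector. When
    both pieces are determined, inequality of the images means that some [gam j] has a strict sign,
    and each choice of [j] and sign is a system to be eliminated. *)
Lemma lineality_region i i' : determined i ->
  finite_union (semipolyhedron false)
    [set x | forall y, A_ i' y -> (forall j, g j (f_ i x - f_ i' y) = 0) ->
       f_ i x = f_ i' y].
Proof.
move=> di.
pose sg (s : bool) : R := if s then 1 else -1.
have both (z : R) : (forall s, sg s * z <= 0) <-> z = 0.
  split=> [h|-> s]; last by rewrite mulr0.
  by have := h true; have := h false; rewrite /sg /=; lra.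
pose h (js : 'I_n * bool) z := sg js.2 * g js.1 (f_ i z.1 - f_ i' z.2).
have hb js : biaffine (h js) by apply/biaffineZ/biaffine_difference.
have hE x y : (forall js, h js (x, y) <= 0) <->
    forall j, g j (f_ i x - f_ i' y) = 0.
  split=> [hle j|g0 js]; last exact: (proj2 (both _) (g0 js.1) js.2).
  by apply/both => s; exact: (hle (j, s)).
have [di'|ndi'] := pselect (determined i'); last first.
  (* [f_ i'] is not constant on the solutions [y], so there are none *)
  apply: finite_union_ext
    (@unsolvable_on_piece false i' _ h (fun=> true) hb _) => // x /=.
  split=> [nex y Ay /hE gy|H [y [Ay /hE gy]]]; first by case: nex; exists y.
  apply: ndi' => v Vv gv.
  have fyv : f_ i' (y + v) = f_ i' y + T i' v by rewrite /f_ linearD addrAC.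
  apply: (addrI (f_ i' y)); rewrite addr0 -fyv -(H y Ay gy).
  apply/esym/H => [k|j].
    by rewrite linearD Vv addr0; exact: Ay.
  by rewrite fyv opprD addrA linearB /= gv subr0.
have [p [gam [gb gE]]] := determined_difference di di'.
(* [None] is the strict inequality giving [gam l.1] the sign chosen by [l.2]; the [Some js] are the
   weak ones forcing every [g j] of the difference to vanish. *)
have U (l : 'I_p * bool) : finite_union (semipolyhedron false)
    [set x | ~ exists y, A_ i' y /\ forall o : option ('I_n * bool),
      (if o is Some js then h js (x, y) else sg l.2 * gam l.1 (x, y)) < 0
        ?<= if (o : bool)].
  apply: finite_union_ext (@unsolvable_on_piece false i' (option ('I_n * bool))
    (fun o => if o is Some js then h js else fun z => sg l.2 * gam l.1 z)
    (fun o => o : bool) _ _) => [x|[js|]|//]; last 2 first.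
  - exact: hb.
  - exact: biaffineZ.
  split=> nex [y [Ay yP]]; apply: nex; exists y; split=> // -[js|].
  - exact: (yP (Some js)).
  - exact: (yP None).
  - exact: (yP (Some js)).
  - exact: (yP None).
have := finite_union_bigcap (semipolyhedronT false) (@semipolyhedronI _ _ _) U.
apply: finite_union_ext => x; split=> [H y Ay gy|H l _ [y [Ay yP]]].
  apply/gE => j; apply/both => s; rewrite leNgt; apply/negP => gt0.
  apply: (H (j, ~~ s) I); exists y; split=> // -[js|] /=; last first.
    by move: gt0; rewrite /sg; case: s => /=; lra.
  by move/hE: gy; exact.
have := yP None; rewrite /= (proj1 (gE x y)) ?mulr0 ?ltxx//.
apply: H => //; apply/hE => js; exact: (yP (Some js)).
Qed.

Lemma closed_cone_region f A i :
    A = \bigcup_i A_ i -> (forall i x, A_ i x -> f x = f_ i x) ->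
  exists2 B, finite_union (semipolyhedron false) B &
    forall x, A_ i x ->
      B x <-> undominated ([set y | forall j, g j y <= 0] `\ 0) f A x.
Proof.
move=> Ap fp; have [di|ndi] := pselect (determined i); last first.
  exists set0; first exact: finite_union0.
  move=> x Ax; rewrite undominated_piecesE//; split=> // nd.
  (* If [T i h] were nonzero, [x + h] would dominate [x]: the difference of images is [- T i h],
     which also lies in the lineality space. *)
  apply: ndi => h Vh gh; apply: contrapT => Th; apply: (nd i).
  have fxh : f_ i x - f_ i (x + h) = - T i h.
    by rewrite /f_ [T i (x + h)]linearD [X in _ - X = _]addrAC opprD addrA subrr
      add0r.
  exists (x + h); rewrite fxh; split=> [k|].
    by rewrite linearD Vh addr0; exact: Ax.
  split=> [j|/= /eqP]; first by rewrite linearN /= gh oppr0.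
  by rewrite oppr_eq0 => /eqP.
(* A nonzero element of the cone either makes some [g j0] negative or lies in the lineality space;
   [B1] excludes the first kind, [B2] the second. In [B1], [None] stands for the strict inequality
   at [j0], [Some k] for the weak one at [k]. *)
pose B1 i' j0 := [set x | ~ exists y, A_ i' y /\ forall o : option 'I_n,
  g (odflt j0 o) (f_ i x - f_ i' y) < 0 ?<= if (o : bool)].
pose B2 i' := [set x | forall y, A_ i' y ->
  (forall j, g j (f_ i x - f_ i' y) = 0) -> f_ i x = f_ i' y].
exists (\bigcap_i' ((\bigcap_j0 B1 i' j0) `&` B2 i')).
  have QT := @semipolyhedronT R X false; have QI := @semipolyhedronI R X false.
  apply: (finite_union_bigcap QT QI) => i'; apply: (finite_union_setI QI).
    apply: (finite_union_bigcap QT QI) => j0.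
    apply: (@unsolvable_on_piece false i' (option 'I_n)
      (fun o z => g (odflt j0 o) (f_ i z.1 - f_ i' z.2))
      (fun o => o : bool)) => // o.
    exact: biaffine_difference.
  exact: lineality_region.
move=> x Ax; rewrite undominated_piecesE//.
split=> [BP i' [y [Ay [Cy /eqP y0]]]|nd i' _].
  have [B1x B2x] := BP i' I.
  move: y0; rewrite subr_eq0 => /eqP; apply; apply: B2x => // j.
  apply/eqP; rewrite eq_le Cy leNgt /=; apply/negP => lt0.
  by apply: (B1x j I); exists y; split=> // -[k|//]; exact: Cy.
split=> [j0 _ [y [Ay yP]]|y Ay gy].
  apply: (nd i'); exists y; split=> //; split=> [j|/= y0].
    exact: (yP (Some j)).
  by have := yP None; rewrite /= y0 linear0 ltxx.
apply: contrapT => /eqP; rewrite -subr_eq0 => /eqP ne.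
by apply: (nd i'); exists y; split=> //; split=> // j; rewrite gy.
Qed.

End closed_cone.
End pieces.

(** * Application to the piecewise linear problem *)

Theorem corollary4p2 (R : realType) (X Y : normedModType R)
  (C : set Y)
  (C_closed : closed C) (C_convex : convex_set (C : set (convex_lmodType Y)))
  (C_cone : cone C)
  (l : nat) (f : X -> Y) (phi : 'I_l -> X -> R^o)
  (f_pl : piecewise_linear f) (phi_pl : forall j, piecewise_linear (phi j))
  (m : nat) (q : 'I_m -> nat)
  (T : 'I_m -> {linear X -> Y}) (b : 'I_m -> Y)
  (u : forall i : 'I_m, 'I_(q i) -> {linear X -> R^o})
  (t : forall i : 'I_m, 'I_(q i) -> R)
  (xs : 'I_m -> 'I_l -> {linear X -> R^o}) (c : 'I_m -> 'I_l -> R)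
  (T_cont : forall i, continuous (T i))
  (u_cont : forall i k, continuous (u i k))
  (xs_cont : forall i j, continuous (xs i j))
  (P : 'I_m -> set X) (P_def : forall i, P i = ineq_set (u i) (t i))
  (P_cover : [set: X] = \bigcup_i P i)
  (P_int : forall i, interior (P i) !=set0)
  (P_disj : forall i i', i != i' -> P i `&` interior (P i') = set0)
  (f_P : forall i x, P i x -> f x = T i x + b i)
  (phi_P : forall i j x, P i x -> phi j x = xs i j x - c i j)
  (C_polyhedral : polyhedron C) :
  let A := [set x | forall j, phi j x <= 0] in
  let S := pareto_sol C f A in
  let Sw := weak_pareto_sol C f A in
  let A_ i := P i `&` ineq_set (xs i) (c i) in
  let f_ i x := T i x + b i in
  (interior C !=set0 ->
    exists (p : nat) (F : 'I_p -> set X),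
      [/\ forall k, polyhedron (F k),
          Sw = \bigcup_k F k &
          forall k, exists i G,
            weak_pareto_face C (f_ i) (A_ i) G /\ F k `<=` G]) /\
  (exists (p : nat) (F : 'I_p -> set X),
      [/\ forall k, generalized_polyhedron (F k),
          S = \bigcup_k F k &
          forall k, exists i G,
            pareto_face C (f_ i) (A_ i) G /\ F k `<=` G]).
Proof.
move=> A S Sw A_ f_.
(* The inequalities of [P i] and the feasibility constraints on it form one system, so that [A_ i]
   is a single [weak_ineq_set]. *)
pose K i := ('I_(q i) + 'I_l)%type.
pose V i (k : K i) := match k with inl k => u i k | inr j => xs i j end.
pose r i (k : K i) := match k with inl k => t i k | inr j => c i j end.
have V_cont i k : continuous (@V i k).
  by case: k => [k|j]; [exact: u_cont|exact: xs_cont].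
have A_E i : A_ i = weak_ineq_set (@V i) (@r i).
  rewrite /A_ P_def; apply/seteqP; split=> x.
    by move=> [ux xsx] [k|j]; [exact: ux|exact: xsx].
  by move=> Vx; split=> k; [exact: (Vx (inl k))|exact: (Vx (inr k))].
have A_pieces : A = \bigcup_i weak_ineq_set (@V i) (@r i).
  apply/seteqP; split=> [x Ax|x [i _]].
    have [i _ Px] : (\bigcup_i P i) x by rewrite -P_cover.
    exists i => //; rewrite -A_E; split=> // j.
    by have := Ax j; rewrite (phi_P i)// subr_le0.
  by rewrite -A_E => -[Px xsx] j; rewrite (phi_P i)// subr_le0.
have f_pieces i x : weak_ineq_set (@V i) (@r i) x -> f x = T i x + b i.
  by rewrite -A_E => -[/f_P].
have [n [g [g_cont CE]]] := polyhedral_cone C_cone C_polyhedral.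
split=> [_|].
  have [J [g' [g'_cont intE]]] := interior_polyhedral_cone g_cont.
  rewrite -CE in intE.
  have [|p [F [FP SwE]]] := undominated_decomposition V_cont A_pieces f_pieces _
      (fun i => open_cone_region V_cont T_cont i g'_cont A_pieces f_pieces).
    by move=> a y a0 yP j; rewrite linearZ /= pmulr_rlt0.
  exists p, F; split=> [k||k].
  - exact: semipolyhedron_polyhedron (FP k).1.
  - by rewrite -SwE /Sw weak_pareto_solE intE.
  - have [_ [i [G [Gf Gd FG]]]] := FP k.
    by exists i, G; split=> //; split; rewrite ?weak_pareto_solE A_E ?intE.
have [|p [F [FP SE]]] := undominated_decomposition V_cont A_pieces f_pieces _
    (fun i => closed_cone_region V_cont T_cont g_cont i A_pieces f_pieces).
  move=> a y a0 [yP y0]; split=> [j|/= /eqP].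
    by rewrite linearZ /= pmulr_rle0.
  by rewrite scaler_eq0 gt_eqF//= => /eqP.
rewrite -CE in FP SE.
exists p, F; split=> [k||k].
- exact: semipolyhedron_generalized (FP k).1.
- by rewrite -SE /S pareto_solE.
- have [_ [i [G [Gf Gd FG]]]] := FP k.
  by exists i, G; split=> //; split; rewrite ?pareto_solE A_E.
Qed.
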